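(* Let $T$ be a tree and let $f:T\to T$ be a continuous map such that no cut-point of $T$ is periodic under $f$. Let $s$, an endpoint of $T$, be the unique attracting fixed point of $f$. Then for each $x\in T$ at least one of the following holds: (a) $f^n(x)$ is a periodic point of $f$ for some $n\ge0$; (b) $f^n(x)\to s$ as $n\to\infty$.
   Context: An interval is any space homeomorphic to $[0,1]\subset\mathbb{R}$. A tree is a (metrizable) uniquely arcwise connected space that is either a single point or a union of finitely many intervals. The valence of $x\in T$ is the number of connected components of $T\setminus\{x\}$. Points of valence one are the endpoints of $T$; points of valence greater than one are the cut-points of $T$. A point $x$ is periodic under $f$ if $f^k(x)=x$ for some $k\ge1$. A point $x$ is called an attracting fixed point of a continuous map $f:X\to X$ if for any open set $U\ni x$ there is an open set $V$ with $x\in V\subseteq U$ and $f(\overline{V})\subseteq V$. (When no cut-point of $T$ is fixed and $T$ is not a single point, $f$ has a unique attracting fixed point, and it is an endpoint of $T$.) *)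

(* Defs.v *)
From HB Require Import structures.
From mathcomp Require Import all_boot all_order all_algebra.
From mathcomp Require Import all_classical all_reals.
From mathcomp Require Import topology normedtype.

Set Implicit Arguments.
Unset Strict Implicit.
Unset Printing Implicit Defensive.

Import Order.TTheory GRing.Theory Num.Theory.
Import numFieldNormedType.Exports.

Local Open Scope classical_set_scope.
Local Open Scope ring_scope.

(** [f] restricts to a homeomorphism from the subspace [A] onto the subspace
    [B], with inverse the restriction of [g]; the values of [f] outside [A] and
    of [g] outside [B] are irrelevant. *)
Definition homeomorphism_between (T U : topologicalType)
    (A : set T) (B : set U) (f : T -> U) (g : U -> T) : Prop :=
  [/\ {within A, continuous f}, {within B, continuous g},
      f @` A = B & {in A, cancel f g}].

Definition homeomorphic (T U : topologicalType) (A : set T) (B : set U) : Prop :=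
  exists f g, homeomorphism_between A B f g.

Definition metrizable (R : realType) (T : topologicalType) : Prop :=
  exists M : metricType R, homeomorphic [set: T] [set: M].

Definition interval_set (R : realType) (T : topologicalType) (A : set T) : Prop :=
  homeomorphic (`[0, 1]%classic : set R) A.

Definition arc_between (R : realType) (T : topologicalType)
    (x y : T) (A : set T) : Prop :=
  exists (f : R -> T) (g : T -> R),
    [/\ homeomorphism_between (`[0, 1]%classic : set R) A f g, f 0 = x & f 1 = y].

(** Arcs are subsets of the space: uniqueness is uniqueness of the subset, not
    of its parametrization. *)
Definition uniquely_arcwise_connected (R : realType) (T : topologicalType) : Prop :=
  forall x y : T, x <> y -> exists! A : set T, arc_between R x y A.

Definition finite_union_of_intervals (R : realType) (T : topologicalType) : Prop :=
  exists F : set (set T),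
    [/\ finite_set F, F !=set0, forall A, F A -> interval_set R A
      & \bigcup_(A in F) A = [set: T]].

Definition is_tree (R : realType) (T : topologicalType) : Prop :=
  [/\ metrizable R T, uniquely_arcwise_connected R T
    & (exists p : T, [set: T] = [set p]) \/ finite_union_of_intervals R T].

Definition punctured_components (T : topologicalType) (x : T) : set (set T) :=
  [set connected_component (~` [set x]) y | y in ~` [set x]].

(** The valence of [x] is the cardinality of [punctured_components x]. *)
Definition endpoint (T : topologicalType) (x : T) : Prop :=
  (punctured_components x #= `I_1)%card.

Definition cut_point (T : topologicalType) (x : T) : Prop :=
  (`I_2 #<= punctured_components x)%card.

Definition periodic_point (T : Type) (f : T -> T) (x : T) : Prop :=
  exists2 k : nat, (1 <= k)%N & iter k f x = x.

(** In a T1 space the condition forces [f x = x], since [f x] belongs to every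
    neighborhood of [x]. *)
Definition attracting_fixed_point (T : topologicalType) (f : T -> T) (x : T) : Prop :=
  forall U : set T, open U -> U x ->
    exists V : set T, [/\ open V, V x, V `<=` U & f @` closure V `<=` V].

(* Main.v *)
Require Import Defs.
From mathcomp Require Import all_boot all_order all_algebra.
From mathcomp Require Import all_classical all_reals.
From mathcomp Require Import topology normedtype.
From mathcomp Require Import lra.

Set Implicit Arguments.
Unset Strict Implicit.
Unset Printing Implicit Defensive.

Import Order.TTheory GRing.Theory Num.Theory.
Import numFieldNormedType.Exports.
Local Open Scope classical_set_scope.
Local Open Scope ring_scope.

(** Root the tree at the attracting fixed point [s] and write [y <= z] when [y]
    separates [s] from [z] or is one of them, that is, when [y] lies on the arc
    from [s] to [z] ([below s y z]).

    The map can never push a point up this order: if [c <> s] and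
    [c <= f^k c] with [k >= 1], then [f^k c = c] ([no_ascent]).  Indeed, points
    of the arc from [s] to [c] that are close to [s] are not pushed up, because
    [s] attracts; if [c] were pushed strictly up, then at the infimum of the
    points of the arc that are pushed strictly up, [f^k] would have a fixed
    point, which is a cut point.

    Near a point [y <> s] every point is comparable with [y]
    ([near_comparable]): the tree is locally a finite star, each ray of which
    either runs along the arc back to [s] or leaves it.  So suppose that the
    orbit of [x] accumulates at [y <> s].  If it never meets the points above
    [y], it has a term [z < y], with [z <> s] because [s] is fixed; the points
    above [z] are a neighborhood of [y], so a later term is above [z], whence
    [z], a cut point, is periodic.  This is excluded, so some [f^n x] with
    [n >= 1] is above [y] ([orbit_above]).

    Now the limit set of [x] is compact and invariant, hence contains a
    recurrent point [y] ([recurrent_point]).  If [y = s], the orbit of [x]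
    enters arbitrarily small trapping neighborhoods of [s] and converges to [s].
    Otherwise [orbit_above] applied to [y] itself, with [no_ascent], makes [y]
    periodic, so that [y] is not a cut point and nothing lies strictly above it;
    [orbit_above] applied to [x] then puts [y] on the orbit of [x]. *)

(** * Injective paths and arcs *)

Lemma inf_closed_mem (R : realType) (E : set R) :
  closed E -> has_inf E -> E (inf E).
Proof.
move=> cE iE; apply: contrapT => nE.
have /nbhs_ballP[e /= e0 be] : nbhs (inf E) (~` E).
  by apply: open_nbhs_nbhs; split => //; apply: closed_openC.
have [r Er re] := inf_adherent e0 iE.
apply: (be r) => //; rewrite /ball /= ltr_norml.
have : inf E <= r by apply: ge_inf => //; case: iE.
by move: re; lra.
Qed.

Lemma continuous_glue (R : realType) (T : topologicalType) (a b : R -> T) (t : R) :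
  continuous a -> continuous b -> a t = b t ->
  continuous (fun x => if x <= t then a x else b x).
Proof.
move=> ca cb ab x; rewrite /continuous_at.
have [xt|tx|xt] := ltgtP x t.
- apply: cvg_trans (ca x); apply: near_eq_cvg.
  near=> y; have yt : y < t by near: y; exact: lt_nbhsl.
  by rewrite (ltW yt).
- apply: cvg_trans (cb x); apply: near_eq_cvg.
  near=> y; have yt : t < y by near: y; exact: lt_nbhsr.
  by rewrite leNgt yt.
- move=> B nB; have nB' : nbhs (b x) B by rewrite xt -ab -xt.
  apply: (@filterS2 _ (nbhs x) _ _ _ _ _ (ca x _ nB) (cb x _ nB')) => y ? ?.
  by rewrite /=; case: ifP.
Unshelve. all: by end_near. Qed.

(** Only the values on the segment from [u] to [v] matter; asking for continuity
    on the whole line spares the subspace topology when paths are glued,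
    restricted or reversed. *)
Definition injective_path (R : realType) (T : topologicalType)
    (a : R -> T) (u v : R) : Prop :=
  [/\ continuous a, u < v & {in `[u, v] &, injective a}].

Lemma path_compact (R : realType) (T : topologicalType) (a : R -> T) (u v : R) :
  continuous a -> compact (a @` `[u, v]).
Proof.
move=> ca; apply: continuous_compact; last exact: segment_compact.
exact: continuous_subspaceT.
Qed.

Lemma path_connected (R : realType) (T : topologicalType) (a : R -> T) (u v : R) :
  continuous a -> connected (a @` `[u, v]).
Proof.
move=> ca; apply: connected_continuous_connected; first exact: segment_connected.
exact: continuous_subspaceT.
Qed.

(** Compactness of the segment makes the inverse of an injective path
    continuous: the image of the complement of [O] is closed and misses [a t]. *)
Lemma near_injective_path (R : realType) (T : topologicalType) (a : R -> T)
    (u v t : R) (O : set R) :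
  hausdorff_space T -> injective_path a u v -> t \in `[u, v] -> nbhs t O ->
  \forall z \near a t, forall r, r \in `[u, v] -> a r = z -> O r.
Proof.
move=> hT [ca uv ia] tuv; rewrite nbhsE => -[B [oB Bt] BO].
have cK : closed (a @` (`[u, v] `&` ~` B)).
  apply: compact_closed => //; apply: continuous_compact.
    exact: continuous_subspaceT.
  by apply: compact_closedI; [exact: segment_compact|exact: open_closedC].
have : nbhs (a t) (~` (a @` (`[u, v] `&` ~` B))).
  apply: open_nbhs_nbhs; split; first exact: closed_openC.
  by move=> [r [ruv nBr] /ia rt]; apply: nBr; rewrite rt.
apply: filterS => z nz r ruv rz; apply: BO; apply: contrapT => nBr.
by apply: nz; exists r.
Qed.

Lemma reparametrize (R : realType) (T : topologicalType) (a : R -> T) (u v c d : R) :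
  continuous a -> continuous (fun t : R => a (c + t * d)).
Proof.
move=> ca t; apply: continuous_comp; last exact: ca.
apply: cvgD; first exact: cvg_cst.
by apply: cvgM; [exact: cvg_id|exact: cvg_cst].
Qed.

Lemma injective_path_arc (R : realType) (T : topologicalType) (a : R -> T) (u v : R) :
  hausdorff_space T -> injective_path a u v ->
  arc_between R (a u) (a v) (a @` `[u, v]).
Proof.
move=> hT [ca uv ia].
have in_uv t : t \in `[0, 1] -> u + t * (v - u) \in `[u, v].
  by rewrite !in_itv /= => /andP[t0 t1]; apply/andP; split; nra.
pose b (t : R) := a (u + t * (v - u)).
have inj_b : injective_path b 0 1.
  split; [exact: reparametrize|exact: ltr01|].
  move=> x y /in_uv xuv /in_uv yuv /(ia _ _ xuv yuv) /addrI.
  by apply: mulIf; rewrite subr_eq0 gt_eqF.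
exists b.
exists (fun z => xget 0 [set t | t \in `[0, 1] /\ b t = z]).
have K t : t \in `[0, 1] -> xget 0 [set r | r \in `[0, 1] /\ b r = b t] = t.
  move=> t01; case: xgetP => [r _ [r01]|/(_ t) []//].
  by case: inj_b => _ _; exact.
have b_ab : b @` `[0, 1] = a @` `[u, v].
  apply/seteqP; split=> [_ [t /= t01 <-]|_ [t /= tuv <-]].
    by exists (u + t * (v - u)) => //=; exact: in_uv.
  exists ((t - u) / (v - u)).
    move: tuv; rewrite !in_itv /= => /andP[ut tv].
    by rewrite divr_ge0 ?ler_pdivrMr ?mul1r ?subr_ge0 ?subr_gt0 ?lerB// ltW.
  by rewrite /b divfK ?subr_eq0 ?gt_eqF// addrC subrK.
split; [split => //|by rewrite /b mul0r addr0|by rewrite /b mul1r addrC subrK].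
- by apply: continuous_subspaceT; case: inj_b.
- apply/subspace_continuousP => z; rewrite -b_ab => -[t t01 <-] B /=.
  rewrite /from_subspace K// => nB; apply: filterS (near_injective_path hT inj_b t01 nB).
  by move=> w Bw [r r01 rw]; rewrite -rw /= K//; exact: Bw.
- by move=> t; rewrite inE => /K.
Qed.

(** The parametrization is extended to the line by clamping to the unit
    segment. *)
Lemma arc_injective_path (R : realType) (T : topologicalType) (x y : T) (A : set T) :
  arc_between R x y A ->
  exists a : R -> T, [/\ injective_path a 0 1, a 0 = x, a 1 = y & A = a @` `[0, 1]].
Proof.
move=> [f [g [[cf _ fA fK] f0 f1]]].
pose cl (t : R) := Num.max 0 (Num.min 1 t) : R.
have clE t : t \in `[0, 1] -> cl t = t.
  by rewrite in_itv /= => /andP[t0 t1]; rewrite /cl min_r// max_r.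
have cl01 t : cl t \in `[0, 1].
  by rewrite in_itv /= /cl le_max lexx /= ge_max ler01 ge_min lexx.
have c_cl : continuous cl.
  move=> t; apply: (@continuous_max R R (fun=> 0) (fun t => Num.min 1 t)).
    exact: cvg_cst.
  by apply: (@continuous_min R R (fun=> 1) id); [exact: cvg_cst|exact: cvg_id].
have clf t : t \in `[0, 1] -> f (cl t) = f t by move/clE ->.
exists (f \o cl); split => /=; last first.
- by rewrite -fA; apply: eq_imagel => t /= /clE ->.
- by rewrite clf// in_itv /= ler01 lexx.
- by rewrite clf// in_itv /= ler01 lexx.
split; [|exact: ltr01|].
  move=> t B nB; have /subspace_continuousP/(_ _ (cl01 t)) := cf.
  move=> /(_ _ nB) /= /(c_cl t) /= H.
  apply: (@filterS _ (nbhs t) _ _ _ _ H) => r /=; apply; exact: cl01.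
move=> r t r01 t01 /=; rewrite !clE// => rt.
by rewrite -(fK r) ?inE// rt fK ?inE.
Qed.

Lemma injective_path_sub (R : realType) (T : topologicalType) (a : R -> T)
    (u v c d : R) :
  injective_path a u v -> u <= c -> c < d -> d <= v -> injective_path a c d.
Proof.
move=> [ca uv ia] uc cd dv; split => // x y.
rewrite !in_itv /= => /andP[cx xd] /andP[cy yd]; apply: ia; rewrite in_itv /=.
- by rewrite (le_trans uc)//= (le_trans xd).
- by rewrite (le_trans uc)//= (le_trans yd).
Qed.

Lemma injective_path_opp (R : realType) (T : topologicalType) (a : R -> T) (u v : R) :
  injective_path a u v -> injective_path (fun t => a (- t)) (- v) (- u).
Proof.
move=> [ca uv ia]; split; last 2 first.
- by rewrite ltrN2.
- move=> x y; rewrite !in_itv /= => /andP[vx xu] /andP[vy yu] xy.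
  apply: oppr_inj; apply: ia xy; rewrite in_itv /=.
  + by rewrite lerNr xu lerNl vx.
  + by rewrite lerNr yu lerNl vy.
by move=> x; apply: continuous_comp; [exact: opp_continuous|exact: ca].
Qed.

Lemma arc_sym (R : realType) (T : topologicalType) (x y : T) (A : set T) :
  hausdorff_space T -> arc_between R x y A -> arc_between R y x A.
Proof.
move=> hT /arc_injective_path[a [ia <- <- ->]].
have := injective_path_arc hT (injective_path_opp ia).
rewrite !opprK; suff -> : (fun t => a (- t)) @` `[- 1, - 0] = a @` `[0, 1] by [].
apply/seteqP; split=> [_ [t /= t01 <-]|_ [t /= t01 <-]]; exists (- t);
  rewrite ?opprK//=; move: t01; rewrite !in_itv /= oppr0 => /andP[? ?].
  by rewrite oppr_ge0 lerNl; apply/andP.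
by rewrite lerN2 oppr_le0; apply/andP.
Qed.

Lemma arc_compact (R : realType) (T : topologicalType) (x y : T) (A : set T) :
  arc_between R x y A -> compact A.
Proof. by move=> /arc_injective_path[a [[ca _ _] _ _ ->]]; exact: path_compact. Qed.

Lemma arc_connected (R : realType) (T : topologicalType) (x y : T) (A : set T) :
  arc_between R x y A -> connected A.
Proof. by move=> /arc_injective_path[a [[ca _ _] _ _ ->]]; exact: path_connected. Qed.

Lemma arc_ends (R : realType) (T : topologicalType) (x y : T) (A : set T) :
  arc_between R x y A -> [/\ A x, A y & x <> y].
Proof.
move=> /arc_injective_path[a [[_ _ ia] <- <- ->]]; split.
- by exists 0 => //=; rewrite in_itv /= lexx ler01.
- by exists 1 => //=; rewrite in_itv /= lexx ler01.
- move=> /ia; rewrite !in_itv /= !lexx !ler01 => /(_ isT isT) /eqP.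
  by rewrite eq_sym oner_eq0.
Qed.

(** The last clause serves antisymmetry of the order below: stopping early
    leaves the endpoint out. *)
Lemma arc_initial_segment (R : realType) (T : topologicalType) (x y z : T) (A : set T) :
  hausdorff_space T -> arc_between R x y A -> A z -> z <> x ->
  exists2 B, arc_between R x z B & B `<=` A /\ (z <> y -> ~ B y).
Proof.
move=> hT /arc_injective_path[a [ia <- <- ->]] [t /= t01 <-] tx.
have [ca _ inj_a] := ia; move: (t01); rewrite in_itv /= => /andP[t0 t1].
have t_gt0 : 0 < t by rewrite lt_neqAle t0 andbT; apply/eqP => t0'; apply: tx; rewrite -t0'.
exists (a @` `[0, t]).
  by apply: injective_path_arc => //; exact: injective_path_sub ia _ _ _.
split=> [_ [r /= + <-]|nt [r /= + r1]]; rewrite in_itv /= => /andP[r0 rt].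
  by exists r => //=; rewrite in_itv /= r0 (le_trans rt).
apply: nt; rewrite -r1; congr a; apply: le_anti; rewrite rt /=.
suff -> : r = 1 by rewrite t1.
by apply: (inj_a _ _ _ _ r1); rewrite in_itv /= ?r0 ?lexx ?ler01// (le_trans rt).
Qed.

(** Follow [A] up to the first point that lies on [B], then follow [B].  The
    switching point witnesses the last clause, which shows, when [A] and [B]
    meet only at [y], that the new arc passes through [y]. *)
Lemma arc_glue (R : realType) (T : topologicalType) (x y z : T) (A B : set T) :
  hausdorff_space T -> arc_between R x y A -> arc_between R y z B -> x <> z ->
  exists E, [/\ arc_between R x z E, E `<=` A `|` B & A `&` B `&` E !=set0].
Proof.
move=> hT arcA arcB xz.
have [_ Ay _] := arc_ends arcA; have [By _ _] := arc_ends arcB.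
have clB : closed B by apply: compact_closed => //; exact: arc_compact arcB.
have /arc_injective_path[a [[ca _ ia] a0 a1 EA]] := arcA.
have /arc_injective_path[b [[cb _ ib] b0 b1 EB]] := arcB.
(* the infimum of [S] is the first time at which [a] hits [B] *)
pose S : set R := `[0, 1]%classic `&` a @^-1` B.
have cS : closed S.
  apply: closedI; first exact: interval_closed.
  by apply: preimage_closed => // t _; exact: ca.
have infS : has_inf S.
  split; first by exists 1; split; [rewrite /= in_itv /= lexx ler01|rewrite /preimage /= a1].
  by exists 0 => t [/=]; rewrite in_itv /= => /andP[].
have [] := inf_closed_mem cS infS.
set t := inf S => /= t01 Bat.
have S_ge r : 0 <= r -> r <= 1 -> B (a r) -> t <= r.
  move=> r0 r1 Br; apply: ge_inf; first by case: infS.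
  by split => //=; rewrite in_itv /= r0 r1.
have [r r01 bra] : (b @` `[0, 1]) (a t) by rewrite -EB.
move: (t01) (r01); rewrite /= !in_itv /= => /andP[t0 t1] /andP[r0 r1].
(* otherwise the path would be constant, with [x = z] *)
have tr : 0 < t + (1 - r).
  rewrite lt_neqAle; apply/andP; split; last by lra.
  apply/eqP => tr; have tE : t = 0 by lra.
  have rE : r = 1 by lra.
  by apply: xz; rewrite -a0 -b1 -tE -rE.
pose c (w : R) := if w <= t then a w else b ((r - t) + w * 1).
have ct : c t = a t by rewrite /c lexx.
have cend : c (t + (1 - r)) = z.
  rewrite /c -b1; case: ifPn => [le1|_]; last by congr b; lra.
  have r1' : r = 1 by lra.
  by rewrite r1' subrr addr0 -bra r1'.
have ic : injective_path c 0 (t + (1 - r)).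
  split=> //.
    apply: continuous_glue => //; first exact: reparametrize.
    by rewrite -bra; congr b; lra.
  have key w w' : 0 <= w -> w <= t -> t < w' -> w' <= t + (1 - r) ->
      a w = b (r - t + w' * 1) -> False.
    move=> w0 wt tw' w'e aw.
    have tw : t <= w.
      apply: S_ge => //; first by lra.
      by rewrite EB; exists (r - t + w' * 1) => //=; rewrite in_itv /=; lra.
    have wE : w = t by lra.
    move: aw; rewrite wE -bra => /ib; rewrite !in_itv /= => H.
    have : r = r - t + w' * 1 by apply: H; apply/andP; split; lra.
    by lra.
  move=> w w'; rewrite !in_itv /= => /andP[w0 we] /andP[w'0 w'e]; rewrite /c.
  case: ifPn => wt; case: ifPn => w't.
  - by apply: ia; rewrite in_itv /=; apply/andP; split; lra.
  - by rewrite -ltNge in w't; move=> /key; case.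
  - by rewrite -ltNge in wt; move=> /esym /key; case.
  - rewrite -!ltNge in wt w't.
    move=> /ib; rewrite !in_itv /= => H.
    suff : r - t + w * 1 = r - t + w' * 1 by lra.
    by apply: H; apply/andP; split; lra.
exists (c @` `[0, t + (1 - r)]); split.
- rewrite -cend -a0; have -> : a 0 = c 0 by rewrite /c t0.
  exact: injective_path_arc.
- move=> _ [w /= + <-]; rewrite in_itv /= => /andP[w0 we]; rewrite /c.
  case: ifPn => wt.
    by left; rewrite EA; exists w => //=; rewrite in_itv /= w0 (le_trans wt).
  rewrite -ltNge in wt; right; rewrite EB.
  by exists (r - t + w * 1) => //=; rewrite in_itv /=; apply/andP; split; lra.
- exists (a t); split; first by split=> //; rewrite EA; exists t.
  by exists t => //=; rewrite in_itv /= t0; lra.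
Qed.

(** Near [p], a finite union of arcs consists of finitely many rays issuing from
    [p], at most two on each arc through [p], while the arcs that miss [p] stay
    away from it.  So a property that holds at the start of every ray holds near
    [p]. *)
Lemma near_star (R : realType) (T : topologicalType) (p : T) (Q : set T) :
  hausdorff_space T -> finite_union_of_intervals R T -> Q p ->
  (forall (a : R -> T) (u v : R), injective_path a u v -> a u = p ->
     exists2 w, u < w & forall t, u < t -> t < w -> t <= v -> Q (a t)) ->
  \forall z \near p, Q z.
Proof.
move=> hT [F [finF _ intF covF]] Qp half.
have nearA A : F A -> \forall z \near p, A z -> Q z.
  move=> /intF[f [g fg]].
  have arcA : arc_between R (f 0) (f 1) A by exists f, g.
  have [Ap|nAp] := pselect (A p); last first.
    have : nbhs p (~` A).
      apply: open_nbhs_nbhs; split => //; apply: closed_openC.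
      by apply: compact_closed => //; exact: arc_compact arcA.
    exact: filterS.
  have /arc_injective_path[a [ia _ _ EA]] := arcA.
  move: Ap; rewrite EA => -[t0 /= t001 at0].
  have := t001; rewrite in_itv /= => /andP[t0_ge0 t0_le1].
  (* [wr] and [wl] bound the two rays; at an end of the arc one of them is
     empty and any bound will do *)
  have [wr t0r Hr] : exists2 w, t0 < w & forall t, t0 < t -> t < w -> t <= 1 -> Q (a t).
    have [t1|t1] := ltP t0 1; last by exists (t0 + 1) => [|t]; lra.
    by apply: half at0; exact: injective_path_sub ia _ _ _.
  have [wl t0l Hl] : exists2 w, w < t0 & forall t, w < t -> t < t0 -> 0 <= t -> Q (a t).
    have [t0'|t0'] := ltP 0 t0; last by exists (t0 - 1) => [|t]; lra.
    have /injective_path_opp/half := injective_path_sub ia (lexx 0) t0' t0_le1.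
    rewrite opprK => /(_ at0)[w tw H]; exists (- w) => [|t wt tt0 t_ge0]; first by lra.
    by rewrite -[t]opprK; apply: H; lra.
  have nt0 : nbhs t0 `]wl, wr[%classic.
    by apply: open_nbhs_nbhs; split; [exact: interval_open|rewrite /= in_itv /= t0l].
  rewrite -at0; apply: filterS (near_injective_path hT ia t001 nt0).
  move=> z Hz [t /= t01 atz]; have := Hz t t01 atz; rewrite /= in_itv /= => /andP[lt tr].
  move: t01; rewrite in_itv /= -atz => /andP[t_ge0 t_le1].
  have [tt0|tt0|->] := ltgtP t t0; [exact: Hl|exact: Hr|by rewrite at0].
have : \forall z \near p, forall A, F A -> A z -> Q z.
  have /finite_seqP[s Fs] := finF; rewrite Fs in nearA *.
  elim: s nearA {Fs} => [|A s IH] nearA; first exact: filterE.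
  have nA : nbhs p (fun z => A z -> Q z) by apply: nearA; rewrite /= mem_head.
  have {}IH : \forall z \near p, forall A, [set` s] A -> A z -> Q z.
    by apply: IH => B Bs; apply: nearA; rewrite /= in_cons; apply/orP; right.
  by apply: filterS2 nA IH => z Az Bz B /=; rewrite in_cons => /orP[/eqP->|/Bz].
apply: filterS => z Hz.
by have [A FA Az] : (\bigcup_(A in F) A) z by [rewrite covF|]; exact: Hz FA Az.
Qed.

(** * The order of a rooted tree *)

Lemma connected_locally_constant (T : topologicalType) (C S : set T) (x y : T) :
  connected C -> (forall w, C w -> \forall w' \near w, S w <-> S w') ->
  C x -> C y -> S x -> S y.
Proof.
move=> conC locS Cx Cy Sx.
suff CSE : C `&` S = C by have [] : (C `&` S) y by rewrite CSE.
have locI w : C w -> S w -> S° w by move=> Cw Sw; apply: filterS (locS w Cw) => w' [+ _]; exact.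
have locC w : C w -> ~ S w -> (~` S)° w.
  by move=> Cw Sw; apply: filterS (locS w Cw) => w' [_ h] /h.
apply: conC; first by exists x.
- exists S°; first exact: open_interior.
  by apply/seteqP; split=> w [Cw Sw]; split=> //; [exact: locI|exact: interior_subset].
- exists (~` (~` S)°); first by apply: open_closedC; exact: open_interior.
  apply/seteqP; split=> w [Cw Sw]; split=> //; first by move=> /interior_subset; apply.
  by apply: contrapT => nSw; apply: Sw; exact: locC.
Qed.

(** A short enough initial segment of each ray at [p] stays inside [U]. *)
Lemma near_arc (R : realType) (T : topologicalType) (p : T) (U : set T) :
  hausdorff_space T -> finite_union_of_intervals R T -> nbhs p U ->
  \forall z \near p, z = p \/ exists2 A, arc_between R p z A & A `<=` U.
Proof.
move=> hT finT nU; apply: (near_star hT finT); first by left.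
move=> a u v ia au.
have [ca uv inj_a] := ia.
have : nbhs u (a @^-1` U) by apply: ca; rewrite au.
move=> /nbhs_ballP[e /= e0 He]; exists (u + e) => [|t ut te tv]; first by lra.
right; exists (a @` `[u, t]).
  by rewrite -au; apply: injective_path_arc => //; exact: injective_path_sub ia _ _ _.
move=> _ [r /= + <-]; rewrite in_itv /= => /andP[ur rt]; apply: He.
by rewrite /ball /= ltr_norml; lra.
Qed.

Lemma hausdorff_near_neq (T : topologicalType) (x y : T) :
  hausdorff_space T -> x <> y -> nbhs x (~` [set y]).
Proof.
move=> hT xy; apply: open_nbhs_nbhs; split => //; apply: closed_openC.
exact: accessible_closed_set1 (hausdorff_accessible hT) y.
Qed.

(** In a tree this says that [y] lies on the arc from [s] to [z], so it is the
    partial order of the tree rooted at [s].  Phrased with connected sets, it is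
    transitive by definition, it exhibits [y] as a cut point, and it is locally
    constant in [z] off [y]. *)
Definition below (T : topologicalType) (s y z : T) : Prop :=
  forall C : set T, connected C -> C s -> C z -> C y.

Lemma below_refl (T : topologicalType) (s y : T) : below s y y.
Proof. by []. Qed.

Lemma below_trans (T : topologicalType) (s x y z : T) :
  below s x y -> below s y z -> below s x z.
Proof. by move=> xy yz C conC Cs Cz; apply: xy => //; exact: yz. Qed.

Lemma below_root (T : topologicalType) (s y : T) : below s y s -> y = s.
Proof. by move=> /(_ [set s]); apply => //; exact: connected1. Qed.

(** A connected set that avoids [y] stays among the points that an arc avoiding
    [y] joins to [s], since those are open and closed off [y].  If [z] were one
    of them, there would be two arcs from [s] to [z]. *)
Lemma arc_below (R : realType) (T : topologicalType) (s y z : T) (A : set T) :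
  hausdorff_space T -> uniquely_arcwise_connected R T ->
  finite_union_of_intervals R T ->
  arc_between R s z A -> A y -> below s y z.
Proof.
move=> hT uT finT arcA Ay C conC Cs Cz; apply: contrapT => nCy.
pose S w := w = s \/ exists2 B, arc_between R s w B & ~ B y.
have SS w w' B : arc_between R w w' B -> ~ B y -> S w -> S w'.
  move=> arcB nBy [ws|[D arcD nDy]]; first by right; exists B; rewrite -?ws.
  have [sw'|sw'] := pselect (s = w'); first by left.
  have [E [arcE EDB _]] := arc_glue hT arcD arcB sw'.
  by right; exists E => // /EDB[].
have : S z.
  apply: (connected_locally_constant conC _ Cs Cz); last by left.
  move=> w Cw; have wy : w <> y by move=> wy; apply: nCy; rewrite -wy.
  apply: filterS (near_arc hT finT (hausdorff_near_neq hT wy)) => w' [->//|[B arcB By]].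
  have nBy : ~ B y by move=> /By; exact.
  by split; [exact: SS nBy|apply: SS nBy; exact: arc_sym].
have [_ _ sz] := arc_ends arcA.
move=> [/esym//|[B arcB]]; apply.
have [A' [_ uA]] := uT _ _ sz.
by rewrite -(uA _ arcB) (uA _ arcA).
Qed.

(** Hence the points strictly above [y] form an open set, and the points above
    [y] a closed one. *)
Lemma near_below (R : realType) (T : topologicalType) (s y z : T) :
  hausdorff_space T -> finite_union_of_intervals R T -> z <> y ->
  \forall z' \near z, below s y z <-> below s y z'.
Proof.
move=> hT finT zy.
have step w w' B : arc_between R w w' B -> ~ B y -> below s y w -> below s y w'.
  move=> arcB nBy yw C conC Cs Cw'; have [Bw Bw' _] := arc_ends arcB.
  have [//|//] : (C `|` B) y.
  apply: yw; [|by left|by right].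
  by apply: connectedU => //; [exists w'|exact: arc_connected arcB].
apply: filterS (near_arc hT finT (hausdorff_near_neq hT zy)) => w' [->//|[B arcB By]].
have nBy : ~ B y by move=> /By; exact.
by split; [exact: step nBy|apply: step nBy; exact: arc_sym].
Qed.

Lemma below_anti (R : realType) (T : topologicalType) (s y z : T) :
  hausdorff_space T -> uniquely_arcwise_connected R T ->
  below s y z -> below s z y -> y = z.
Proof.
move=> hT uT yz zy; apply: contrapT => neq.
have [sz|sz] := pselect (s = z).
  by apply: neq; rewrite -sz; apply: below_root; rewrite {2}sz.
have [ys|ys] := pselect (y = s).
  by apply: neq; rewrite ys; apply/esym/below_root; rewrite -{2}ys.
have [A [arcA _]] := uT _ _ sz.
have [As Az _] := arc_ends arcA.
have Ay : A y by apply: yz => //; exact: arc_connected arcA.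
have [B arcB [_ nBz]] := arc_initial_segment hT arcA Ay ys.
apply: (nBz neq); have [Bs By _] := arc_ends arcB.
by apply: zy => //; exact: arc_connected arcB.
Qed.

Lemma closed_below (R : realType) (T : topologicalType) (s z : T) :
  hausdorff_space T -> uniquely_arcwise_connected R T ->
  finite_union_of_intervals R T -> closed [set y | below s y z].
Proof.
move=> hT uT finT; have [<-|sz] := pselect (s = z).
  rewrite (_ : [set y | _] = [set s]).
    exact: accessible_closed_set1 (hausdorff_accessible hT) s.
  by apply/seteqP; split=> y /= => [/below_root|->].
have [A [arcA _]] := uT _ _ sz; have [As Az _] := arc_ends arcA.
rewrite (_ : [set y | _] = A); first by apply: compact_closed => //; exact: arc_compact arcA.
apply/seteqP; split=> y /= => [|Ay]; last exact: arc_below arcA Ay.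
by apply => //; exact: arc_connected arcA.
Qed.

(** On each ray from [y]: if the arc from [y] to [s] meets the ray away from [y],
    it contains the start of the ray by uniqueness of arcs, and the points there
    are below [y].  If not, the arc from [s] to [y] continues along the ray, and
    the points of the ray are above [y]. *)
Lemma near_comparable (R : realType) (T : topologicalType) (s y : T) :
  hausdorff_space T -> uniquely_arcwise_connected R T ->
  finite_union_of_intervals R T -> y <> s ->
  \forall z \near y, below s y z \/ below s z y.
Proof.
move=> hT uT finT ys; apply: (near_star hT finT); first by left.
move=> a u v ia au; have [ca uv inj_a] := ia.
have [A [arcA _]] := uT _ _ ys; have [Ay As _] := arc_ends arcA.
have arc_a t : u < t -> t <= v -> arc_between R y (a t) (a @` `[u, t]).
  move=> ut tv; rewrite -au; apply: injective_path_arc => //.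
  exact: injective_path_sub ia _ _ _.
have [[t1 [ut1 t1v At1]]|none] := pselect (exists t, [/\ u < t, t <= v & A (a t)]).
  exists t1 => // t ut tt1 _; right.
  have arc1 := arc_a _ ut1 t1v; have [_ _ yt1] := arc_ends arc1.
  have [B arcB [BA _]] := arc_initial_segment hT arcA At1 (nesym yt1).
  apply: (arc_below hT uT finT (arc_sym hT arcA)); apply: BA.
  have [D [_ uD]] := uT _ _ yt1.
  rewrite -(uD _ arcB) (uD _ arc1).
  by exists t => //=; rewrite in_itv /=; lra.
exists (v + 1) => [|t ut _ tv]; first by lra.
left; have st : s <> a t by move=> st; apply: none; exists t; rewrite -st.
have [E [arcE _ [q [[Aq [r /= + rq]] Eq]]]] :=
  arc_glue hT (arc_sym hT arcA) (arc_a _ ut tv) st.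
rewrite in_itv /= => /andP[ur rt].
apply: (arc_below hT uT finT arcE).
suff -> : y = q by [].
have [ru|ur'] := leP r u; first by rewrite -rq -au; congr a; lra.
by case: none; exists r; split=> //; [lra|rewrite rq].
Qed.

Lemma below_cut_point (T : topologicalType) (s y z : T) :
  below s y z -> y <> s -> y <> z -> cut_point y.
Proof.
move=> yz ys yz'; rewrite /cut_point.
pose c w := connected_component (~` [set y]) w.
have cs : ~ c s z.
  move=> csz; have : c s y.
    apply: yz => //; first exact: component_connected.
    by apply: connected_component_refl => /esym.
  by move=> /connected_component_sub; exact.
have : c z z by apply: connected_component_refl => /esym.
move=> czz; have cne : c s <> c z by move=> e; apply: cs; rewrite e.
pose h (A : set T) : nat := if `[< A = c s >] then 0%N else 1%N.
have img : `I_2 `<=` h @` punctured_components y.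
  move=> [|[|//]] _; [exists (c s)|exists (c z)]; rewrite /h.
  - by exists s => // /esym.
  - by case: asboolP.
  - by exists z => // /esym.
  - by case: asboolP => // /esym.
exact: card_le_trans (subset_card_le img) (card_image_le _ _).
Qed.

(** * Attraction to the root *)

Lemma left_approximation (R : realType) (l u e : R) :
  l < u -> 0 < e -> exists r, [/\ l <= r, r < u & u - e < r].
Proof.
move=> lu e0; have [le|le] := leP l (u - e / 2).
  by exists (u - e / 2); split; lra.
by exists l; split; lra.
Qed.

(** The set [V] plays the trapping neighborhood of the root.  The arc from [s] to
    [c] leaves [V] at a point that is not pushed up: the image of the arc up to
    that point is connected, contains [s], and stays inside [V].  Let [u] be the
    infimum of the later parameters at which points are pushed strictly up.
    Being pushed strictly up is an open condition which persists to the left,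
    so it fails at [u].  As there is no fixed point at [u] either, [a u] is not
    below its image, which is an open condition too: nothing is pushed up just
    to the right of [u], a contradiction. *)
Lemma no_ascent (R : realType) (T : topologicalType) (s c : T) (g : T -> T)
    (V : set T) :
  hausdorff_space T -> uniquely_arcwise_connected R T ->
  finite_union_of_intervals R T -> continuous g ->
  open V -> V s -> ~ V c -> g @` closure V `<=` V -> g s = s -> c <> s ->
  (forall y, below s y c -> y <> s -> y <> c -> g y <> y) ->
  below s c (g c) -> g c = c.
Proof.
move=> hT uT finT cg oV Vs nVc gV gs cs nofix cgc; apply: contrapT => gcc.
have [A [arcA _]] := uT _ _ (nesym cs).
have /arc_injective_path[a [ia a0 a1 EA]] := arcA.
have [ca _ inj_a] := ia.
have mono t t' : 0 <= t -> t <= t' -> t' <= 1 -> below s (a t) (a t').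
  move=> t_ge0; rewrite le_eqVlt => /orP[/eqP <- _|tt' t'1]; first exact: below_refl.
  have arc' : arc_between R s (a t') (a @` `[0, t']).
    rewrite -a0; apply: injective_path_arc => //.
    by apply: injective_path_sub ia _ _ _ => //; lra.
  by apply: (arc_below hT uT finT arc'); exists t => //=; rewrite in_itv /=; lra.
have a_inj t t' : 0 <= t -> t <= 1 -> 0 <= t' -> t' <= 1 -> a t = a t' -> t = t'.
  by move=> *; apply: inj_a => //; rewrite in_itv /=; apply/andP.
pose S : set R := `[0, 1]%classic `&` a @^-1` (~` V).
have clS : closed S.
  apply: closedI; first exact: interval_closed.
  by apply: preimage_closed; [move=> t _; exact: ca|exact: open_closedC].
have infS : has_inf S.
  split; first by exists 1; split; [rewrite /= in_itv /= lexx ler01|rewrite /preimage /= a1].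
  by exists 0 => t [/=]; rewrite in_itv /= => /andP[].
have [] := inf_closed_mem clS infS.
set t0 := inf S => /= t001 nVt0; move: t001; rewrite in_itv /= => /andP[t0_ge0 t0_le1].
have S_ge r : 0 <= r -> r < t0 -> V (a r).
  move=> r0 r1; apply: contrapT => nV; suff : t0 <= r by lra.
  by apply: ge_inf; [case: infS|split => //=; rewrite in_itv /=; lra].
have t0_gt0 : 0 < t0.
  rewrite lt_neqAle t0_ge0 andbT; apply/eqP => t0E.
  by apply: nVt0; rewrite -t0E a0.
have clV t : 0 <= t -> t <= t0 -> closure V (a t).
  move=> t_ge0; rewrite le_eqVlt => /orP[/eqP ->|tt0]; last first.
    by apply: subset_closure; exact: S_ge.
  move=> B nB; have /nbhs_ballP[e /= e0 He] : nbhs t0 (a @^-1` B) by exact: ca.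
  have [r [r0 rt r_e]] := left_approximation t0_gt0 e0.
  exists (a r); split; first exact: S_ge.
  by apply: He; rewrite /ball /= ltr_norml; lra.
have not_up : ~ below s (a t0) (g (a t0)).
  move=> up; apply: nVt0.
  have con : connected (g @` (a @` `[0, t0])).
    apply: connected_continuous_connected; first exact: path_connected.
    exact: continuous_subspaceT.
  have sub : g @` (a @` `[0, t0]) `<=` V.
    move=> _ [_ [t /= + <-] <-]; rewrite in_itv /= => /andP[t_ge0 tt0].
    by apply: gV; exists (a t) => //; exact: clV.
  apply: sub; apply: up con _ _.
    by exists s => //; exists 0; rewrite //= in_itv /= lexx.
  by exists (a t0) => //; exists t0; rewrite //= in_itv /= lexx andbT.
pose A' : set R := [set t | [/\ t0 <= t, t <= 1, below s (a t) (g (a t)) & g (a t) <> a t]].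
have infA : has_inf A'.
  by split; [exists 1; split; rewrite ?a1|exists t0 => t []].
pose u := inf A'.
have u_le t : A' t -> u <= t by move=> A't; apply: ge_inf => //; case: infA.
have t0u : t0 <= u by apply: lb_le_inf => [|t []//]; case: infA.
have u1 : u <= 1 by apply: u_le; split; rewrite ?a1.
have cga : continuous (g \o a) by move=> t; apply: continuous_comp; [exact: ca|exact: cg].
have [[_ _ upu neu]|nA'] := pselect (A' u).
  have t0u' : t0 < u.
    by rewrite lt_neqAle t0u andbT; apply/eqP => e; apply: not_up; rewrite e.
  have nb : \forall w \near g (a u), below s (a u) w.
    by apply: filterS (near_below s hT finT neu) => w [+ _]; exact.
  have /nbhs_ballP[e /= e0 He] := cga u _ nb.
  have [r [r0 ru r_e]] := left_approximation t0u' e0.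
  have upr : below s (a u) (g (a r)).
    apply: (He r); rewrite /ball /= ltr_norml; lra.
  have ru' : below s (a r) (a u) by apply: mono; lra.
  suff : u <= r by lra.
  apply: u_le; split; [lra|lra|exact: below_trans upr|].
  move=> gr; rewrite gr in upr; have := below_anti hT uT ru' upr.
  move=> /a_inj H; have : r = u by apply: H; lra.
  by lra.
have u_lt1 : u < 1.
  by rewrite lt_neqAle u1 andbT; apply/eqP => u1'; apply: nA'; rewrite u1'; split; rewrite ?a1.
have gu : g (a u) <> a u.
  apply: nofix; first by rewrite -a1; apply: mono; lra.
    rewrite -a0 => /a_inj H; have : u = 0 by apply: H; lra.
    by lra.
  rewrite -a1 => /a_inj H; have : u = 1 by apply: H; lra.
  by lra.
(* [a r], slightly below [a u], is still not below the image of [a u] *)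
have nup : ~ below s (a u) (g (a u)) by move=> up; apply: nA'.
have : nbhs (a u) (~` [set y | below s y (g (a u))]).
  by apply: open_nbhs_nbhs; split => //; apply: closed_openC; exact: closed_below hT uT finT.
move=> /ca /nbhs_ballP[e /= e0 He].
have [r [r0 ru r_e]] := left_approximation (lt_le_trans t0_gt0 t0u) e0.
have nr : ~ below s (a r) (g (a u)).
  apply: (He r); rewrite /ball /= ltr_norml; lra.
have gur : g (a u) <> a r by move=> e'; apply: nr; rewrite e'.
(* a point [a t] with [t >= u] that is pushed up would put [a r] below its image *)
have nb : \forall w \near g (a u), ~ below s (a r) w.
  by apply: filterS (near_below s hT finT gur) => w [_ h] /h.
have /nbhs_ballP[d /= d0 Hd] := cga u _ nb.
have [t A't tu] := inf_adherent d0 infA.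
have ut := u_le _ A't; have [t0t t1 upt _] := A't.
apply: (Hd t); first by rewrite /ball /= ltr_norml /u; rewrite -/u in tu *; lra.
by apply: below_trans upt; apply: mono; lra.
Qed.

(** * Limit points of orbits *)

Definition limit_point_of_orbit (T : topologicalType) (f : T -> T) (x y : T) : Prop :=
  forall (N : nat) (B : set T), nbhs y B -> exists2 n, (N <= n)%N & B (iter n f x).

(** Every point of a minimal nonempty closed invariant subset of [K] is recurrent,
    since the closure of each tail of its orbit is closed and invariant.  The
    minimal subset is produced by Zorn's lemma as the part of [K] outside a
    maximal open set [U]; compactness keeps unions of chains from covering
    [K]. *)
Lemma recurrent_point (T : topologicalType) (f : T -> T) (K : set T) :
  continuous f -> compact K -> K !=set0 -> f @` K `<=` K ->
  exists2 y, K y & limit_point_of_orbit f y y.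
Proof.
move=> cf coK K0 fK.
pose P (U : set T) := [/\ open U, f @^-1` U `<=` U & ~ K `<=` U].
have [|U [[oU fU nKU] maxU]] := @Zorn_bigcup T P.
  move=> F FP totF; split.
  - by apply: bigcup_open => U /FP[].
  - by move=> z [U FU Ufz]; exists U => //; have [_ + _] := FP _ FU; apply.
  - have [F0|/set0P/negP] := pselect (F !=set0); last first.
      rewrite negbK => /eqP ->; rewrite bigcup_set0.
      by have [z Kz] := K0; move=> H; exact: (H z Kz).
    move=> covK.
    pose G : set_system T := [set A | exists2 U, F U & K `\` U `<=` A].
    have GF : ProperFilter G.
      split.
        move=> [U /FP[_ _ nKU] KU0]; apply: nKU => z Kz.
        by apply: contrapT => nUz; exact: (KU0 z).
      split.
      - by have [U FU] := F0; exists U.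
      - move=> A B [U FU UA] [W FW WB].
        have [UW|WU] := totF _ _ FU FW.
        + exists W => // z [Kz nWz]; split; [|exact: WB].
          by apply: UA; split => // /UW.
        + exists U => // z [Kz nUz]; split; [exact: UA|].
          by apply: WB; split => // /WU.
      - by move=> A B AB [U FU UA]; exists U => //; exact: subset_trans AB.
    have GK : G K by have [U FU] := F0; exists U => // z [].
    have [q [Kq clq]] := coK G GF GK.
    have [U FU Uq] := covK q Kq; have [oU _ _] := FP _ FU.
    have GKU : G (K `\` U) by exists U.
    by have [z [[_ nUz] Uz]] := clq _ _ GKU (open_nbhs_nbhs (conj oU Uq)).
have [y Ky nUy] : exists2 y, K y & ~ U y.
  apply: contrapT => H; apply: nKU => z Kz; apply: contrapT => nUz.
  by apply: H; exists z.
have iterK n : K (iter n f y) by elim: n => //= n IH; apply: fK; exists (iter n f y).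
have iterU n : ~ U (iter n f y) by elim: n => //= n IH /fU.
exists y => // N B nB; apply: contrapT => noB.
pose O := [set iter n f y | n in [set n | (N <= n)%N]].
have yO : ~ closure O y.
  by move=> /(_ B nB)[_ [[n /= Nn <-] Bn]]; apply: noB; exists n.
apply: (maxU (U `|` ~` closure O)).
  by split=> [z Uz|/(_ y)/(_ (or_intror yO))//]; left.
split.
- by apply: openU => //; apply: closed_openC; exact: closed_closure.
- move=> z [/fU|nO]; first by left.
  right=> clz; apply: nO => D nD; have := clz _ (cf z _ nD).
  move=> [_ [[n /= Nn <-] Dn]]; exists (iter n.+1 f y); split => //.
  by exists n.+1 => //=; exact: leqW.
- move=> /(_ _ (iterK N))[/iterU//|]; apply.
  by apply: subset_closure; exists N => //=.
Qed.

(** A term of the orbit that is strictly below [y] is not [s], where the orbit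
    would remain; so it would be a cut point, and periodic by the hypothesis that
    nothing moves up, because later terms come back above it on their way to
    [y]. *)
Lemma orbit_above (R : realType) (T : topologicalType) (f : T -> T) (s x y : T) :
  hausdorff_space T -> uniquely_arcwise_connected R T ->
  finite_union_of_intervals R T -> f s = s ->
  (forall c k, c <> s -> (0 < k)%N -> below s c (iter k f c) -> iter k f c = c) ->
  (forall c : T, cut_point c -> ~ periodic_point f c) ->
  limit_point_of_orbit f x y -> y <> s ->
  exists2 n, (0 < n)%N & below s y (iter n f x).
Proof.
move=> hT uT finT fs nret noper limy ys.
have [n n0 [//|ny]] := limy 1%N _ (near_comparable hT uT finT ys); first by exists n.
have [<-|nyE] := pselect (iter n f x = y); first by exists n => //; exact: below_refl.
have upn : \forall w \near y, below s (iter n f x) w.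
  by apply: filterS (near_below s hT finT (nesym nyE)) => w [+ _]; exact.
have ns : iter n f x <> s.
  move=> ns; have [m nm] := limy n _ (hausdorff_near_neq hT ys).
  by apply; rewrite -(subnK nm) iterD ns /=; elim: (m - n)%N => //= k ->.
have [m nm up] := limy n.+1 _ upn.
have mn0 : (0 < m - n)%N by rewrite subn_gt0.
have mE : iter m f x = iter (m - n) f (iter n f x) by rewrite -iterD subnK // ltnW.
rewrite mE in up; have per := nret _ _ ns mn0 up.
by case: (noper _ (below_cut_point ny ns nyE)); exists (m - n)%N.
Qed.

Lemma metrizable_hausdorff (R : realType) (T : topologicalType) :
  metrizable R T -> hausdorff_space T.
Proof.
move=> [M [h [k [ch _ _ hK]]]] x y clxy.
have hc : continuous h by exact/continuous_subspace_setT.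
suff : h x = h y by move=> /(congr1 k); rewrite !hK ?inE.
apply: (@metric_hausdorff R M) => A B nA nB.
have [z [Az Bz]] := clxy _ _ (hc _ _ nA) (hc _ _ nB).
by exists (h z).
Qed.

Lemma finite_union_compact (R : realType) (T : topologicalType) :
  finite_union_of_intervals R T -> compact [set: T].
Proof.
move=> [F [finF _ intF <-]].
have coF A : F A -> compact A.
  by move=> /intF[f [g fg]]; apply: (@arc_compact _ _ (f 0) (f 1)); exists f, g.
have /finite_seqP[l Fl] := finF; rewrite Fl in coF *.
elim: l coF {Fl} => [|A l IH] coF.
  by rewrite (_ : \bigcup_(_ in _) _ = set0); [exact: compact0|apply/seteqP; split=> z []].
rewrite (_ : \bigcup_(_ in _) _ = A `|` \bigcup_(B in [set` l]) B).
  apply: compactU; first by apply: coF; rewrite /= mem_head.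
  by apply: IH => B Bl; apply: coF; rewrite /= in_cons; apply/orP; right.
apply/seteqP; split=> z.
- by move=> [B /=]; rewrite in_cons => /orP[/eqP ->|Bl Bz]; [left|right; exists B].
- by move=> [Az|[B /= Bl Bz]]; [exists A|exists B]; rewrite //= in_cons ?eqxx// Bl orbT.
Qed.

Unset Implicit Arguments.

Theorem lemma5 (R : realType) (T : topologicalType) (f : T -> T) (s : T)
    (treeT : is_tree R T) (cont_f : continuous f)
    (no_periodic_cut_point : forall c : T, cut_point c -> ~ periodic_point f c)
    (endpoint_s : endpoint s)
    (attracting_s : unique (attracting_fixed_point f) s) (x : T) :
  (exists n : nat, periodic_point f (iter n f x)) \/
  iter n f x @[n --> \oo] --> s.
Proof.
have [metT uT [[p Tp]|finT]] := treeT.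
  have single y : y = p by have : [set: T] y by []; rewrite Tp.
  by left; exists 0%N, 1%N => //; rewrite (single (iter _ _ _)) [RHS]single.
have hT := metrizable_hausdorff metT.
have [attr _] := attracting_s.
have fs : f s = s.
  apply: contrapT => fs.
  have := hausdorff_near_neq hT (nesym fs).
  rewrite nbhsE => -[U [oU Us] Ufs].
  have [V [oV Vs VU fV]] := attr U oU Us.
  have /VU/Ufs : V (f s) by apply: fV; exists s => //; exact: subset_closure.
  exact.
have iters k : iter k f s = s by elim: k => //= k ->.
have trap V k : f @` closure V `<=` V -> (0 < k)%N -> iter k f @` closure V `<=` V.
  move=> fV; elim: k => // -[_ _ //|k IH _ _ [z Vz <-]].
  apply: fV; exists (iter k.+1 f z) => //; apply: subset_closure.
  by apply: IH => //; exists z.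
have cont_iter k : continuous (iter k f).
  elim: k => [|k IH] z; first exact: cvg_id.
  by apply: (@continuous_comp _ _ _ (iter k f) f); [exact: IH|exact: cont_f].
have nret c k : c <> s -> (0 < k)%N -> below s c (iter k f c) -> iter k f c = c.
  move=> cs k0 up.
  have := hausdorff_near_neq hT (nesym cs); rewrite nbhsE => -[U [oU Us] Uc].
  have [V [oV Vs VU fV]] := attr U oU Us.
  apply: (@no_ascent R T s c (iter k f) V) => //.
  - by move=> /VU/Uc; exact.
  - exact: trap.
  - move=> y yc ys ync yper.
    by apply: (no_periodic_cut_point y (below_cut_point yc ys ync)); exists k.
have coT := finite_union_compact finT.
pose K := [set y | limit_point_of_orbit f x y].
have clK : closed K.
  move=> y clKy N B; rewrite nbhsE => -[C [oC Cy] CB].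
  have [z [Kz Cz]] := clKy C (open_nbhs_nbhs (conj oC Cy)).
  have [n Nn Cn] := Kz N C (open_nbhs_nbhs (conj oC Cz)).
  by exists n => //; exact: CB.
have K0 : K !=set0.
  have [y [_ cly]] := coT (iter n f x @[n --> \oo]) _ filterT.
  exists y => N B nB.
  have tail : (iter n f x @[n --> \oo]) [set iter n f x | n in [set n | (N <= n)%N]].
    by exists N => // n Nn; exists n.
  by have [_ [[n /= Nn <-] Bn]] := cly _ _ tail nB; exists n.
have fK : f @` K `<=` K.
  move=> _ [y Ky <-] N B nB; have [n Nn Bn] := Ky N _ (cont_f y _ nB).
  by exists n.+1; [exact: leqW|].
have coK : compact K by apply: subclosed_compact clK coT _.
have [y Ky yrec] := recurrent_point cont_f coK K0 fK.
have [ys|ys] := pselect (y = s).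
  right=> B; rewrite nbhsE => -[U [oU Us] UB].
  have [V [oV Vs VU fV]] := attr U oU Us.
  have nVy : nbhs y V by rewrite ys; exact: open_nbhs_nbhs.
  have [n _ Vn] := Ky 0%N V nVy.
  have Vm m : V (iter m f (iter n f x)).
    by elim: m => //= m IH; apply: fV; exists (iter m f (iter n f x)) => //; exact: subset_closure.
  by exists n => // m /= nm; apply/UB/VU; rewrite -(subnK nm) iterD.
left.
have above z := @orbit_above R T f s z y hT uT finT fs nret no_periodic_cut_point.
have [k k0 kup] := above y yrec ys.
have per : iter k f y = y by exact: nret.
have [n n0 nup] := above x Ky ys.
exists n; exists k => //.
suff -> : iter n f x = y by [].
apply: contrapT => nxy.
by apply: (no_periodic_cut_point y (below_cut_point nup ys (nesym nxy))); exists k.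
Qed.
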